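(* Let $R$ be a commutative Noetherian ring, $M$ a finitely generated $R$-module and $N$ a submodule of $M$. Then $$\mathrm{ir}_M(N) = \sum_{\mathfrak p \in \mathrm{Ass}_R(M/N)} \dim_{k(\mathfrak p)} \mathrm{Soc}\big((M/N)_{\mathfrak p}\big).$$ Moreover, for every $\mathfrak p \in \mathrm{Ass}_R(M/N)$ there is a $\mathfrak p$-primary submodule $N(\mathfrak p)$ of $M$ with $\mathrm{ir}_M(N(\mathfrak p)) = \dim_{k(\mathfrak p)} \mathrm{Soc}\big((M/N)_{\mathfrak p}\big)$ such that $$N = \bigcap_{\mathfrak p \in \mathrm{Ass}_R(M/N)} N(\mathfrak p)$$ is an irredundant primary decomposition of $N$.
   Context: A submodule $N$ of $M$ is irreducible if it cannot be written as an intersection of two properly larger submodules of $M$. An irredundant irreducible decomposition of $N$ is an expression of $N$ as a finite intersection of irreducible submodules of $M$ in which no component can be omitted (the empty intersection being $M$). By a classical theorem of Noether such a decomposition exists and the number of its components is independent of the choice of decomposition; this number is the index of reducibility $\mathrm{ir}_M(N)$. For a prime $\mathfrak p$ of $R$, $k(\mathfrak p) = R_{\mathfrak p}/\mathfrak pR_{\mathfrak p}$. For a module $L$ over a local ring $(A,\mathfrak n)$, $\mathrm{Soc}(L) = 0:_L\mathfrak n$, a vector space over $A/\mathfrak n$; here $\mathrm{Soc}((M/N)_{\mathfrak p})$ is the socle of the $R_{\mathfrak p}$-module $(M/N)_{\mathfrak p}$. A submodule $Q$ of $M$ is $\mathfrak p$-primary if $\mathrm{Ass}_R(M/Q)=\{\mathfrak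 p\}$. An irredundant primary decomposition is a finite intersection of primary submodules with pairwise distinct associated primes in which no component can be omitted. *)

(* Defs.v *)
From HB Require Import structures.
From mathcomp Require Import all_boot all_algebra ring.
From mathcomp Require Import boolp classical_sets functions cardinality fsbigop.

Set Implicit Arguments.
Unset Strict Implicit.
Unset Printing Implicit Defensive.

Import GRing.Theory.
Import Quotient.Exports.
Local Open Scope classical_set_scope.
Local Open Scope ring_scope.
Local Open Scope quotient_scope.

(* Submodules are the library's [submodClosed M].  Their membership predicate
   is boolean, which is no restriction in the presence of [asbool]. *)
Section Submodules.
Variables (R : pzRingType) (M : lmodType R).

Lemma submodule_ext (N1 N2 : submodClosed M) : N1 =i N2 -> N1 = N2.
Proof.
case: N1 N2 => [S1 c1] [S2 c2] e.
have eS : S1 = S2 by apply/funext => x; exact: e x.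
subst S2; clear e; congr GRing.SubmodClosed.Pack.
case: c1 c2 => [[a1] [b1]] [[a2] [b2]].
by rewrite (Prop_irrelevance a1 a2) (Prop_irrelevance b1 b2).
Qed.

Definition finitely_generated (A : set M) : Prop :=
  exists (n : nat) (g : 'I_n -> M),
    A = range (fun c : 'I_n -> R => \sum_(i < n) c i *: g i).

Definition irreducible_sub (N : submodClosed M) : Prop :=
  ~ exists N1 N2 : submodClosed M,
      [/\ [set` N] `<` [set` N1], [set` N] `<` [set` N2] &
          [set` N] = [set` N1] `&` [set` N2]].

(* For n = 0 the intersection is the whole of M. *)
Definition irredundant_irreducible_decomposition
    (N : submodClosed M) (n : nat) (Q : 'I_n -> submodClosed M) : Prop :=
  [/\ forall i, irreducible_sub (Q i),
      [set` N] = \bigcap_i [set` Q i] &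
      forall j, [set` N] <> \bigcap_(i in [set~ j]) [set` Q i]].

(* [index_of_reducibility N n] is the assertion that ir_M(N) is well defined
   and equal to n. *)
Definition index_of_reducibility (N : submodClosed M) (n : nat) : Prop :=
  (exists Q : 'I_n -> submodClosed M,
      irredundant_irreducible_decomposition N Q) /\
  (forall (m : nat) (Q : 'I_m -> submodClosed M),
      irredundant_irreducible_decomposition N Q -> m = n).

End Submodules.

Notation ideal R := (submodClosed R^o).

Definition noetherian (R : pzRingType) : Prop :=
  forall I : ideal R, finitely_generated (M := R^o) [set` I].

Section ModuleQuotient.
Variables (R : pzRingType) (M : lmodType R) (N : submodClosed M).

(* [submodClosed] is defined over semirings and does not inherit from
   [zmodClosed]; this copy of N does. *)
Definition zmod_of : {pred M} := N.

Fact zmod_of_add : addr_closed zmod_of.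
Proof. by split=> [|x y]; [exact: rpred0 | exact: rpredD]. Qed.

Fact zmod_of_opp : oppr_closed zmod_of.
Proof. by move=> x xN; rewrite -scaleN1r; exact: rpredZ. Qed.

HB.instance Definition _ := GRing.isAddClosed.Build M zmod_of zmod_of_add.
HB.instance Definition _ := GRing.isOppClosed.Build M zmod_of zmod_of_opp.

Definition mquot := Quotient.quot zmod_of.
HB.instance Definition _ := GRing.Zmodule.on mquot.

Definition mpi (x : M) : mquot := \pi_(Quotient.quot zmod_of) x.

Lemma mpi_eq x y : mpi x = mpi y <-> x - y \in N.
Proof.
rewrite -[x - y \in N]/(x - y \in zmod_of) Quotient.idealrBE.
by split=> [/eqP|/eqP].
Qed.

Lemma mpiK (a : mquot) : mpi (repr (a : Quotient.quot zmod_of)) = a.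
Proof. exact: reprK. Qed.

Lemma mpiD x y : mpi (x + y) = mpi x + mpi y.
Proof. exact: raddfD. Qed.

Definition mquot_scale (r : R) (a : mquot) : mquot :=
  mpi (r *: repr (a : Quotient.quot zmod_of)).

Lemma mquot_scaleE r x : mquot_scale r (mpi x) = mpi (r *: x).
Proof.
by apply/mpi_eq; rewrite -scalerBr rpredZ //; apply/mpi_eq; rewrite mpiK.
Qed.

Fact mquot_scaleA a b v :
  mquot_scale a (mquot_scale b v) = mquot_scale (a * b) v.
Proof. by rewrite -(mpiK v) !mquot_scaleE scalerA. Qed.
Fact mquot_scale1 : left_id 1 mquot_scale.
Proof. by move=> v; rewrite -(mpiK v) mquot_scaleE scale1r. Qed.
Fact mquot_scaleDr : right_distributive mquot_scale +%R.
Proof.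
move=> a u v; rewrite -(mpiK u) -(mpiK v) -mpiD !mquot_scaleE.
by rewrite scalerDr mpiD.
Qed.
Fact mquot_scaleDl v : {morph mquot_scale^~ v : a b / a + b}.
Proof. by move=> a b; rewrite -(mpiK v) !mquot_scaleE scalerDl mpiD. Qed.

HB.instance Definition _ := GRing.Zmodule_isLmodule.Build R mquot
  mquot_scaleA mquot_scale1 mquot_scaleDr mquot_scaleDl.

Lemma mpiZ r x : mpi (r *: x) = r *: mpi x.
Proof. by rewrite -[RHS]/(mquot_scale r (mpi x)) mquot_scaleE. Qed.

End ModuleQuotient.

Definition prime_ideal (R : comPzRingType) (I : {pred R}) : Prop :=
  [/\ submod_closed (I : {pred R^o}), 1 \notin I &
      forall a b : R, a * b \in I -> a \in I \/ b \in I].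

Record spec (R : comPzRingType) : Type := Spec {
  spec_pred : R -> bool;
  spec_prime_subproof : prime_ideal spec_pred
}.

Definition spec_mem (R : comPzRingType) (p : spec R) : {pred R} := spec_pred p.
Coercion spec_mem : spec >-> pred_sort.

Definition spec_prime (R : comPzRingType) (p : spec R) : prime_ideal p :=
  spec_prime_subproof p.

HB.instance Definition _ (R : comPzRingType) := gen_eqMixin (spec R).
HB.instance Definition _ (R : comPzRingType) := gen_choiceMixin (spec R).

Lemma spec_ext (R : comPzRingType) (p q : spec R) : p =i q -> p = q.
Proof.
case: p q => [I hI] [J hJ] /= e.
have eIJ : I = J by apply/funext => a; exact: e a.
by subst J; rewrite (Prop_irrelevance hI hJ).
Qed.

Definition Ass (R : comPzRingType) (L : lmodType R) : set (spec R) :=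
  [set p : spec R | exists x : L, forall a : R, a \in p <-> a *: x = 0].

Section Localization.
Variables (R : comPzRingType) (p : spec R).

Definition denom : Type := {s : R | s \notin p}.
HB.instance Definition _ := Choice.on denom.

Fact denom1_subproof : (1 : R) \notin p.
Proof. by case: (spec_prime p). Qed.
Fact spec0 : 0 \in p.
Proof. by case: (spec_prime p) => -[]. Qed.
Fact specD (a b : R) : a \in p -> b \in p -> a + b \in p.
Proof.
by case: (spec_prime p) => -[_ h] _ _ ap bp; rewrite -[a]mul1r; exact: h.
Qed.
Fact specM (a b : R) : b \in p -> a * b \in p.
Proof.
by case: (spec_prime p) => -[p0 h] _ _ bp; rewrite -[_ * _]addr0; exact: h.
Qed.

Definition denom1 : denom := exist (fun s => is_true (s \notin p)) 1 denom1_subproof.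

Fact denomM_subproof (s t : denom) : sval s * sval t \notin p.
Proof.
case: s t => [s hs] [t ht] /=; apply/negP.
by case: (spec_prime p) => _ _ /[apply] -[] h; move: hs ht; rewrite h.
Qed.
Definition denomM (s t : denom) : denom :=
  exist (fun s => is_true (s \notin p)) _ (denomM_subproof s t).

Section Module.
Variable L : lmodType R.

(* x / s = y / t when u (t x - s y) = 0 for some u outside p. *)
Definition loc_equiv (f g : L * denom) : bool :=
  `[< exists u : denom,
        sval u *: (sval g.2 *: f.1 - sval f.2 *: g.1) = 0 >].

Fact loc_equiv_refl : reflexive loc_equiv.
Proof. by move=> f; apply/asboolP; exists denom1; rewrite subrr scaler0. Qed.

Fact loc_equiv_sym : symmetric loc_equiv.
Proof.
have h f g : loc_equiv f g -> loc_equiv g f.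
  by move=> /asboolP[u hu]; apply/asboolP; exists u;
     rewrite -opprB scalerN hu oppr0.
by move=> f g; apply/idP/idP; exact: h.
Qed.

Fact loc_equiv_trans : transitive loc_equiv.
Proof.
move=> [y t] [x s] [z r] /asboolP[u /= hu] /asboolP[v /= hv].
apply/asboolP; exists (denomM (denomM u v) t) => /=.
move/eqP: hu; rewrite scalerBr subr_eq0 !scalerA => /eqP hu.
move/eqP: hv; rewrite scalerBr subr_eq0 !scalerA => /eqP hv.
apply/eqP; rewrite scalerBr subr_eq0 !scalerA; apply/eqP.
transitivity ((sval v * sval r) *: ((sval u * sval t) *: x)).
  by rewrite !scalerA; congr (_ *: _); ring.
rewrite hu; transitivity ((sval u * sval s) *: ((sval v * sval r) *: y)).
  by rewrite !scalerA; congr (_ *: _); ring.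
by rewrite hv !scalerA; congr (_ *: _); ring.
Qed.

Canonical loc_equiv_rel :=
  EquivRel loc_equiv loc_equiv_refl loc_equiv_sym loc_equiv_trans.

Definition localization : Type := {eq_quot loc_equiv}.
HB.instance Definition _ := Choice.on localization.

Definition frac (x : L) (s : denom) : localization :=
  \pi_{eq_quot loc_equiv} (x, s).

Lemma frac_eq x s y t : frac x s = frac y t <->
  exists u : denom, sval u *: (sval t *: x - sval s *: y) = 0.
Proof.
split=> [/eqmodP/asboolP//|h]; apply/eqmodP; exact/asboolP.
Qed.

Lemma eq_frac (x y : L) s t :
  x = y -> sval s = sval t -> frac x s = frac y t.
Proof. by move=> -> /val_inj ->. Qed.

Definition num (a : localization) : L := (repr (a : {eq_quot loc_equiv})).1.
Definition den (a : localization) : denom :=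
  (repr (a : {eq_quot loc_equiv})).2.

Lemma frac_numden a : frac (num a) (den a) = a.
Proof. by rewrite /frac -surjective_pairing; exact: reprK. Qed.

Definition loc_zero : localization := frac 0 denom1.
Definition loc_opp (a : localization) : localization := frac (- num a) (den a).
Definition loc_add (a b : localization) : localization :=
  frac (sval (den b) *: num a + sval (den a) *: num b) (denomM (den a) (den b)).

Lemma loc_addE x s y t :
  loc_add (frac x s) (frac y t) = frac (sval t *: x + sval s *: y) (denomM s t).
Proof.
rewrite /loc_add.
move: (frac_numden (frac x s)) (frac_numden (frac y t)).
move: (num (frac x s)) (den (frac x s)) (num (frac y t)) (den (frac y t)).
move=> x0 s0 y0 t0.
move=> /frac_eq[u hu] /frac_eq[v hv]; apply/frac_eq.
exists (denomM u v); rewrite /=.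
move/eqP: hu; rewrite scalerBr subr_eq0 !scalerA => /eqP hu.
move/eqP: hv; rewrite scalerBr subr_eq0 !scalerA => /eqP hv.
apply/eqP; rewrite scalerBr subr_eq0 !scalerDr !scalerA; apply/eqP.
congr (_ + _).
  transitivity ((sval v * sval t * sval t0) *: ((sval u * sval s) *: x0)).
    by rewrite !scalerA; congr (_ *: _); ring.
  by rewrite hu !scalerA; congr (_ *: _); ring.
transitivity ((sval u * sval s * sval s0) *: ((sval v * sval t) *: y0)).
  by rewrite !scalerA; congr (_ *: _); ring.
by rewrite hv !scalerA; congr (_ *: _); ring.
Qed.

Lemma loc_oppE x s : loc_opp (frac x s) = frac (- x) s.
Proof.
rewrite /loc_opp; move: (frac_numden (frac x s)).
move: (num _) (den _) => x0 s0 /frac_eq[u hu]; apply/frac_eq; exists u.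
by rewrite !scalerN -opprD scalerN hu oppr0.
Qed.

Fact loc_addA : associative loc_add.
Proof.
move=> a b c; rewrite -(frac_numden a) -(frac_numden b) -(frac_numden c).
rewrite !loc_addE; apply/frac_eq; exists denom1; rewrite scale1r /=.
apply/eqP; rewrite subr_eq0 !scalerDr !scalerA addrA; apply/eqP.
by congr (_ + _ + _); congr (_ *: _); ring.
Qed.
Fact loc_addC : commutative loc_add.
Proof.
move=> a b; rewrite -(frac_numden a) -(frac_numden b) !loc_addE.
apply: eq_frac; first exact: addrC.
exact: mulrC.
Qed.
Fact loc_add0 : left_id loc_zero loc_add.
Proof.
move=> a; rewrite -(frac_numden a) loc_addE; apply/frac_eq; exists denom1.
by rewrite scale1r scaler0 add0r scale1r /= mul1r subrr.
Qed.
Fact loc_addN : left_inverse loc_zero loc_opp loc_add.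
Proof.
move=> a; rewrite -(frac_numden a) loc_oppE loc_addE; apply/frac_eq.
by exists denom1; rewrite scalerN addNr !scaler0 subrr scaler0.
Qed.

HB.instance Definition _ := GRing.isZmodule.Build localization
  loc_addA loc_addC loc_add0 loc_addN.

Lemma fracD x s y t :
  frac x s + frac y t = frac (sval t *: x + sval s *: y) (denomM s t).
Proof. exact: loc_addE. Qed.

End Module.

(* The underlying set of R_p, on which [R^o] is only seen as a module. *)
Definition locring : Type := localization R^o.
HB.instance Definition _ := GRing.Zmodule.on locring.

Section Scale.
Variable L : lmodType R.

Definition loc_scale (a : locring) (x : localization L) : localization L :=
  frac ((num a : R) *: num x) (denomM (den a) (den x)).

Lemma loc_scaleE (r : R) s (x : L) t :
  loc_scale (frac (r : R^o) s) (frac x t) = frac (r *: x) (denomM s t).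
Proof.
rewrite /loc_scale.
move: (frac_numden (frac (r : R^o) s)) (frac_numden (frac x t)).
move: (num (frac (r : R^o) s)) (den (frac (r : R^o) s)).
move: (num (frac x t)) (den (frac x t)) => x0 t0 r0 s0.
move=> /frac_eq[u hu] /frac_eq[v hv]; apply/frac_eq.
exists (denomM u v); rewrite /=.
move/eqP: hu; rewrite scalerBr subr_eq0 !scalerA => /eqP hu.
move/eqP: hv; rewrite scalerBr subr_eq0 !scalerA => /eqP hv.
have {}hu : sval u * sval s * (r0 : R) = sval u * sval s0 * r by exact: hu.
apply/eqP; rewrite scalerBr subr_eq0 !scalerA; apply/eqP.
transitivity ((sval u * sval s * (r0 : R)) *: ((sval v * sval t) *: x0)).
  by rewrite !scalerA; congr (_ *: _); ring.
by rewrite hv hu !scalerA; congr (_ *: _); ring.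
Qed.

End Scale.

Definition loc_one : locring := frac (1 : R^o) denom1.
Definition loc_mul (a b : locring) : locring := loc_scale a b.

Lemma loc_mulE (r1 r2 : R) s1 s2 :
  loc_mul (frac (r1 : R^o) s1) (frac (r2 : R^o) s2)
  = frac (r1 * r2 : R^o) (denomM s1 s2).
Proof. exact: loc_scaleE. Qed.

Fact loc_scaleA (L : lmodType R) (a b : locring) (x : localization L) :
  loc_scale a (loc_scale b x) = loc_scale (loc_mul a b) x.
Proof.
rewrite -(frac_numden a) -(frac_numden b) -(frac_numden x) loc_mulE.
rewrite (loc_scaleE (num b)) !loc_scaleE.
by apply: eq_frac; [rewrite scalerA | exact: mulrA].
Qed.

Fact loc_mulA : associative loc_mul.
Proof. by move=> a b c; exact: loc_scaleA. Qed.
Fact loc_mulC : commutative loc_mul.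
Proof.
move=> a b; rewrite -(frac_numden a) -(frac_numden b) !loc_mulE.
by apply: eq_frac; exact: mulrC.
Qed.
Fact loc_scale1 (L : lmodType R) (x : localization L) : loc_scale loc_one x = x.
Proof.
rewrite -(frac_numden x) loc_scaleE scale1r.
by apply: eq_frac; last exact: mul1r.
Qed.
Fact loc_mul1 : left_id loc_one loc_mul.
Proof. by move=> a; exact: loc_scale1. Qed.
Fact loc_scaleDl (L : lmodType R) (x : localization L) :
  {morph (fun a : locring => loc_scale a x) : a b / a + b}.
Proof.
move=> a b; rewrite -(frac_numden a) -(frac_numden b) -(frac_numden x).
rewrite fracD !loc_scaleE fracD; apply/frac_eq; exists denom1.
rewrite scale1r; apply/eqP; rewrite subr_eq0 !scalerDr !scalerA -scalerDl.
apply/eqP; congr (_ *: _) => /=.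
rewrite -[sval (den b) *: num a]/(sval (den b) * (num a : R)).
rewrite -[sval (den a) *: num b]/(sval (den a) * (num b : R)).
by move: (num a : R) (num b : R) => na nb; ring.
Qed.
Fact loc_scaleDr (L : lmodType R) (a : locring) :
  {morph (@loc_scale L a) : x y / x + y}.
Proof.
move=> x y; rewrite -(frac_numden a) -(frac_numden x) -(frac_numden y).
rewrite fracD !loc_scaleE fracD; apply/frac_eq; exists denom1.
rewrite scale1r; apply/eqP; rewrite subr_eq0 !scalerDr !scalerA.
by apply/eqP; congr (_ + _); congr (_ *: _) => /=; ring.
Qed.
Fact loc_mulDl : left_distributive loc_mul +%R.
Proof. by move=> a b x; exact: loc_scaleDl. Qed.
Fact loc_one_neq0 : loc_one != 0.
Proof.
apply/eqP => /frac_eq[u]; rewrite scale1r scaler0 subr0.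
move=> /(congr1 (fun z : R^o => z : R)); rewrite -[_ *: _]/(sval u * 1) mulr1.
by move=> u0; move: (valP u); rewrite /= u0 spec0.
Qed.

HB.instance Definition _ := GRing.Zmodule_isComNzRing.Build locring
  loc_mulA loc_mulC loc_mul1 loc_mulDl loc_one_neq0.

HB.instance Definition _ (L : lmodType R) :=
  GRing.Zmodule_isLmodule.Build locring (localization L)
    (@loc_scaleA L) (@loc_scale1 L) (@loc_scaleDr L) (@loc_scaleDl L).

Lemma fracM (r1 r2 : R) s1 s2 :
  (frac (r1 : R^o) s1 : locring) * (frac (r2 : R^o) s2 : locring)
  = frac (r1 * r2 : R^o) (denomM s1 s2).
Proof. exact: loc_mulE. Qed.

Lemma fracZ (L : lmodType R) (r : R) s (x : L) t :
  (frac (r : R^o) s : locring) *: frac x t = frac (r *: x) (denomM s t).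
Proof. exact: loc_scaleE. Qed.

(* The maximal ideal p R_p of R_p. *)
Definition locmax : {pred locring} := fun z : locring =>
  `[< exists (a : R) (s : denom), a \in p /\ z = frac (a : R^o) s >].

Fact locmax_closed : idealr_closed locmax.
Proof.
split.
- by apply/asboolP; exists 0, denom1; split=> //; exact: spec0.
- apply/asboolP => -[a [s [ap /frac_eq[u hu]]]].
  have {hu} : sval u * (sval s * 1 - 1 * a) = 0 by exact: hu.
  rewrite mulr1 mul1r mulrBr => /eqP; rewrite subr_eq0 => /eqP hu.
  have : sval u * sval s \in p.
    by rewrite hu; exact: specM.
  case: (spec_prime p) => _ _ /[apply] -[] h.
    by move: (valP u); rewrite /= h.
  by move: (valP s); rewrite /= h.
- move=> c z w /asboolP[a [s [ap ->]]] /asboolP[b [t [bp ->]]].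
  rewrite -(frac_numden c) fracM fracD; apply/asboolP.
  eexists; eexists; split; last by reflexivity.
  by apply: specD; apply: specM => //; apply: specM.
Qed.

HB.instance Definition _ := isIdealr.Build locring locmax locmax_closed.

(* The residue field k(p) = R_p / p R_p. *)
Definition residue : Type := {ideal_quot locmax}.
HB.instance Definition _ := GRing.ComNzRing.on residue.

Fact residue_inv_subproof (a : residue) :
  exists b : residue, if a == 0 then b == 0 else b * a == 1.
Proof.
case: eqP => [_|a0]; first by exists 0.
pose z : locring := repr (a : {ideal_quot locmax}).
have az : a = \pi_({ideal_quot locmax}) z by symmetry; exact: reprK.
have nz : num z \notin p.
  apply/negP => h; apply: a0; rewrite az.
  transitivity (\pi_({ideal_quot locmax}) (0 : locring)); last exact: rmorph0.
  apply/eqP; rewrite -Quotient.idealrBE subr0; apply/asboolP.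
  by exists (num z), (den z); rewrite frac_numden.
pose w : locring :=
  frac (sval (den z) : R^o) (exist (fun s => is_true (s \notin p)) (num z) nz).
exists (\pi_({ideal_quot locmax}) w).
rewrite az; apply/eqP; transitivity (\pi_({ideal_quot locmax}) (w * z)).
  by symmetry; exact: rmorphM.
transitivity (\pi_({ideal_quot locmax}) (1 : locring)); last exact: rmorph1.
congr (\pi_({ideal_quot locmax}) _).
rewrite -(frac_numden z) fracM; apply/frac_eq; exists denom1.
rewrite scale1r; apply/eqP; rewrite subr_eq0 /= scale1r; apply/eqP.
exact: etrans (mulrC _ _) (esym (mulr1 _)).
Qed.

Definition residue_inv (a : residue) : residue :=
  xchoose (residue_inv_subproof a).

Fact residue_invP (a : residue) :
  if a == 0 then residue_inv a == 0 else residue_inv a * a == 1.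
Proof. exact: (xchooseP (residue_inv_subproof a)). Qed.

Fact residue_mulVf a : a != 0 -> residue_inv a * a = 1.
Proof.
by move=> /negPf a0; have := residue_invP a; rewrite a0 => /eqP.
Qed.
Fact residue_inv0 : residue_inv 0 = 0.
Proof. by have := residue_invP 0; rewrite eqxx => /eqP. Qed.

HB.instance Definition _ :=
  GRing.ComNzRing_isField.Build residue residue_mulVf residue_inv0.

End Localization.

Arguments locmax {R} p _.

(* 0 :_L I, as a module over A / I. *)
Section Annihilated.
Variables (A : comNzRingType) (I : idealr A) (L : lmodType A).

Definition killed_by : {pred L} :=
  fun x : L => `[< forall a : A, a \in I -> a *: x = 0 >].

Fact killed_by_closed : submod_closed killed_by.
Proof.
split=> [|a x y /asboolP hx /asboolP hy]; apply/asboolP => b bI.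
  exact: scaler0.
by rewrite scalerDr scalerA mulrC -scalerA hx // hy // scaler0 addr0.
Qed.

Definition annihilated : Type := {x : L | x \in killed_by}.
HB.instance Definition _ := SubChoice.on annihilated.
HB.instance Definition _ := GRing.SubChoice_isSubLmodule.Build
  A L killed_by annihilated killed_by_closed.

Definition ann_scale (k : {ideal_quot I}) (x : annihilated) : annihilated :=
  repr k *: x.

Lemma ann_scaleE (a : A) (x : annihilated) :
  ann_scale (\pi_({ideal_quot I}) a) x = a *: x.
Proof.
rewrite /ann_scale; apply/eqP; rewrite -subr_eq0 -scalerBl; apply/eqP.
apply: val_inj; rewrite linearZ linear0 /=.
have /asboolP := svalP x; apply.
by rewrite Quotient.idealrBE reprK.
Qed.

Fact ann_scaleA a b v : ann_scale a (ann_scale b v) = ann_scale (a * b) v.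
Proof.
by rewrite -[a]reprK -[b]reprK -rmorphM !ann_scaleE scalerA.
Qed.
Fact ann_scale1 : left_id 1 ann_scale.
Proof.
by move=> v; rewrite -(rmorph1 (\pi_({ideal_quot I}))) ann_scaleE scale1r.
Qed.
Fact ann_scaleDr : right_distributive ann_scale +%R.
Proof. by move=> a u v; rewrite /ann_scale scalerDr. Qed.
Fact ann_scaleDl v : {morph ann_scale^~ v : a b / a + b}.
Proof.
by move=> a b; rewrite -[a]reprK -[b]reprK -rmorphD !ann_scaleE scalerDl.
Qed.

End Annihilated.

Section Socle.
Variables (R : comPzRingType) (p : spec R) (L : lmodType R).

(* The socle 0 : p R_p of the R_p-module L_p, as a k(p)-vector space. *)
Definition socle : Type := annihilated (locmax p) (localization p L).
HB.instance Definition _ := GRing.Zmodule.on socle.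

Let scale : residue p -> socle -> socle := @ann_scale _ (locmax p) _.

Fact socle_scaleA (a b : residue p) v : scale a (scale b v) = scale (a * b) v.
Proof. exact: ann_scaleA. Qed.
Fact socle_scale1 : left_id 1 scale.
Proof. exact: ann_scale1. Qed.
Fact socle_scaleDr : right_distributive scale +%R.
Proof. exact: ann_scaleDr. Qed.
Fact socle_scaleDl v : {morph scale^~ v : a b / a + b}.
Proof. exact: ann_scaleDl. Qed.

HB.instance Definition _ := GRing.Zmodule_isLmodule.Build (residue p) socle
  socle_scaleA socle_scale1 socle_scaleDr socle_scaleDl.

Lemma socleZ (a : locring p) (x : socle) :
  sval ((\pi_({ideal_quot locmax p}) a : residue p) *: x) = a *: sval x.
Proof.
transitivity (sval (ann_scale (\pi_({ideal_quot locmax p}) a)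
  (x : annihilated (locmax p) (localization p L)))); first by [].
by rewrite ann_scaleE.
Qed.

End Socle.

Section Dimension.
Variables (K : fieldType) (V : lmodType K).

Definition is_basis (n : nat) (b : 'I_n -> V) : Prop :=
  forall v : V, exists! c : 'rV[K]_n, v = \sum_(i < n) c 0 i *: b i.

Definition finite_dimensional : Prop :=
  exists (n : nat) (b : 'I_n -> V), is_basis b.

(* The value is 0 when V is not finite-dimensional. *)
Definition vdim : nat :=
  xget 0%N [set n | exists b : 'I_n -> V, is_basis b].

End Dimension.

Section Primary.
Variables (R : comPzRingType) (M : lmodType R).

Definition primary (p : spec R) (Q : submodClosed M) : Prop :=
  Ass (mquot Q) = [set p].

Definition irredundant_primary_decomposition (T : Type)
    (N : submodClosed M) (I : set T) (Q : T -> submodClosed M) : Prop :=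
  [/\ finite_set I,
      forall i, I i -> exists p, primary p (Q i),
      forall i j, I i -> I j -> i <> j ->
        Ass (mquot (Q i)) <> Ass (mquot (Q j)),
      [set` N] = \bigcap_(i in I) [set` Q i] &
      forall j, I j -> [set` N] <> \bigcap_(i in I `\ j) [set` Q i]].

End Primary.

(* Main.v *)
From HB Require Import structures.
Require Import Defs.
From mathcomp Require Import all_boot all_algebra.
From mathcomp Require Import boolp classical_sets functions cardinality fsbigop.

Set Implicit Arguments.
Unset Strict Implicit.
Unset Printing Implicit Defensive.

Import Defs GRing.Theory.
Import Quotient.Exports.
Local Open Scope classical_set_scope.
Local Open Scope ring_scope.
Local Open Scope quotient_scope.

(** Let N be the intersection of finitely many irreducible submodules Q_i, none
    of them superfluous.  Irreducibility of Q_i has two consequences.  By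
    Fitting's argument every element of R is nilpotent or regular on M / Q_i
    ([nilpotent_or_regular]), so that Q_i has a prime p_i
    ([irreducible_prime]); and any two nonzero submodules of M / Q_i meet
    ([irreducible_uniform]).  Irredundance gives elements z_i outside Q_i and
    inside all the other Q_j, which can be chosen with p_i as the annihilator
    of z_i modulo Q_i ([irr_decomposition_frame]), hence also modulo N.

    For each prime q, the fractions z_i / 1 with p_i = q form a basis of the
    q-socle of M / N ([frame_basis]).  They are independent because modulo Q_i
    only the term of z_i survives ([frame_independent]).  They generate because
    an element x killed by q modulo N is, modulo each Q_i and up to a
    multiplier outside q, a multiple of z_i if p_i = q and zero otherwise
    ([killed_mod_irreducible]); multiplying by all the multipliers expresses x
    modulo N, by the choice of the z_i ([frame_span]).  The same computation
    shows that Ass(M / N) is the set of the p_i ([frame_Ass]).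

    So the dimension of the q-socle is the number of components with prime q,
    and the total number of components is the sum of these dimensions, whatever
    the decomposition ([frame_card]); this contains Noether's uniqueness
    theorem.  Existence is Noetherian induction
    ([exists_irreducible_decomposition]) followed by a minimal choice.  The
    submodule N(q) is the intersection of the Q_i with p_i = q: those Q_i and
    z_i satisfy the same conditions with respect to N(q)
    ([frame_component]), so everything above applies to N(q) as well. *)

(** * Noetherian modules *)

Section SubmoduleTools.
Variables (R : pzRingType) (M : lmodType R).
Implicit Types (N : submodClosed M) (s : seq M).

Lemma submodule_comprehension (P : M -> Prop) :
  P 0 -> (forall a x y, P x -> P y -> P (a *: x + y)) ->
  exists N, forall x, x \in N <-> P x.
Proof.
move=> P0 Plin; pose S : {pred M} := fun x => `[< P x >].
have S_closed : submod_closed S.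
  split=> [|a x y /asboolP Px /asboolP Py]; first exact/asboolP.
  exact/asboolP/Plin.
pose N : submodClosed M :=
  HB.pack S (GRing.isSubmodClosed.Build R M S S_closed).
by exists N => x; split=> [/asboolP|/asboolP].
Qed.

Lemma mem_subB N x y : x \in N -> y \in N -> x - y \in N.
Proof. by move=> xN yN; rewrite -scaleN1r rpredD // rpredZ. Qed.

Lemma mem_subDl N x y : x \in N -> x + y \in N -> y \in N.
Proof. by move=> xN /mem_subB/(_ xN); rewrite addrC addKr. Qed.

Definition generates s N : Prop :=
  {subset s <= N} /\
  forall N', {subset s <= N'} -> {subset N <= N'}.

Lemma finitely_generatedP N :
  finitely_generated [set` N] -> exists s, generates s N.
Proof.
move=> [n [g Ng]]; exists (codom g); split=> [_ /codomP[i ->]|N' sN' x xN].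
  suff : [set` N] (g i) by [].
  rewrite Ng; exists (fun j => (j == i)%:R) => //.
  rewrite (bigD1 i) //= eqxx scale1r big1 ?addr0 // => j /negPf ->.
  by rewrite scale0r.
have : [set` N] x by [].
rewrite Ng => -[c _ <-]; apply: rpred_sum => i _; apply: rpredZ.
exact/sN'/codom_f.
Qed.

(** The submodule generated by [s], presented one generator at a time so that
    induction on [s] peels off a cyclic quotient. *)
Fixpoint span_seq s (x : M) : Prop :=
  if s is g :: s' then exists a : R, span_seq s' (x - a *: g) else x = 0.

Lemma span_seq0 s : span_seq s 0.
Proof. by elim: s => //= g s IH; exists 0; rewrite scale0r subr0. Qed.

Lemma span_seq_lin s a x y :
  span_seq s x -> span_seq s y -> span_seq s (a *: x + y).
Proof.
elim: s x y => /= [x y -> ->|g s IH x y [b xb] [c yc]].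
  by rewrite scaler0 addr0.
exists (a * b + c); suff -> : a *: x + y - (a * b + c) *: g
    = a *: (x - b *: g) + (y - c *: g) by exact: IH.
by rewrite scalerBr scalerA scalerDl opprD addrACA.
Qed.

Lemma span_seq_sum (I : eqType) (r : seq I) (c : I -> R) (g : I -> M) :
  span_seq (map g r) (\sum_(i <- r) c i *: g i).
Proof.
elim: r => [|i r IH] /=; first by rewrite big_nil.
by exists (c i); rewrite big_cons addrC addKr.
Qed.

End SubmoduleTools.

Lemma ideal_comprehension (R : pzRingType) (P : R -> Prop) :
  P 0 -> (forall a b c, P b -> P c -> P (a * b + c)) ->
  exists I : ideal R, forall a : R, a \in I <-> P a.
Proof. exact: (@submodule_comprehension R R^o P). Qed.

Section Noetherian.
Variables (R : pzRingType) (M : lmodType R).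
Implicit Types N : submodClosed M.

Definition noetherian_module : Prop := forall N, exists s, generates s N.

(** Hilbert's basis argument for modules: the leading coefficients of the
    elements of N form an ideal, and lifts of its generators generate N
    modulo the part of N spanned by the remaining generators. *)
Lemma noetherian_fg :
  noetherian R -> finitely_generated [set: M] -> noetherian_module.
Proof.
move=> hR [n [g Mg]] N.
have : forall x, x \in N -> span_seq (map g (index_enum 'I_n)) x.
  move=> x _; have : [set: M] x by [].
  by rewrite Mg => -[c _ <-]; exact: span_seq_sum.
elim: {Mg n g}(map g _) N => [|g s IH] N Ns.
  exists [::]; split=> // N' _ x /Ns /= ->; exact: rpred0.
have [I memI] : exists I : ideal R, forall a : R, a \in I <->
    exists2 x, x \in N & span_seq s (x - a *: g).
  apply: ideal_comprehension.
    by exists 0; rewrite ?rpred0 // scale0r subr0; exact: span_seq0.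
  move=> a b c [x xN sx] [y yN sy]; exists (a *: x + y).
    by rewrite rpredD // rpredZ.
  suff -> : a *: x + y - (a * b + c) *: g
      = a *: (x - b *: g) + (y - c *: g) by exact: span_seq_lin.
  by rewrite scalerBr scalerA scalerDl opprD addrACA.
have [K memK] : exists K : submodClosed M,
    forall x, x \in K <-> x \in N /\ span_seq s x.
  apply: submodule_comprehension.
    by rewrite rpred0; split=> //; exact: span_seq0.
  move=> a x y [xN sx] [yN sy]; split; last exact: span_seq_lin.
  by rewrite rpredD // rpredZ.
have [t [tK genK]] : exists t, generates t K by apply: IH => x /memK[].
have [u [uI genI]] : exists u : seq R^o, generates u I.
  exact: finitely_generatedP (hR I).
have /choice[f fP] : forall a : R, exists x,
    a \in I -> x \in N /\ span_seq s (x - a *: g).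
  move=> a; case: (boolP (a \in I)) => [/memI[x]|_]; last by exists 0.
  by exists x.
exists (t ++ map f u); split=> [x|N' sN' x xN].
  rewrite mem_cat => /orP[/tK/memK[]//|/mapP[a /uI aI ->]].
  by have [] := fP a aI.
have KN' : {subset K <= N'}.
  by apply: genK => y yt; apply: sN'; rewrite mem_cat yt.
have [J memJ] : exists J : ideal R, forall a : R, a \in J <->
    exists2 y, y \in N /\ y \in N' & span_seq s (y - a *: g).
  apply: ideal_comprehension.
    by exists 0; rewrite ?rpred0 // scale0r subr0; exact: span_seq0.
  move=> a b c [y [yN yN'] sy] [z [zN zN'] sz]; exists (a *: y + z).
    by rewrite !rpredD // rpredZ.
  suff -> : a *: y + z - (a * b + c) *: g
      = a *: (y - b *: g) + (z - c *: g) by exact: span_seq_lin.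
  by rewrite scalerBr scalerA scalerDl opprD addrACA.
(* The coefficients of g that are realized inside N' include the generators
   of I, hence all of I. *)
have IJ : {subset I <= J}.
  apply: genI => a au; apply/memJ.
  have [faN fas] := fP a (uI _ au); exists (f a) => //; split=> //.
  by apply: sN'; rewrite mem_cat map_f ?orbT.
have [a sa] := Ns x xN.
have /IJ/memJ[y [yN yN'] sy] : a \in I by apply/memI; exists x.
rewrite -[x](subrK y) rpredD //; apply/KN'/memK; split; first exact: mem_subB.
suff -> : x - y = -1 *: (y - a *: g) + (x - a *: g) by exact: span_seq_lin.
by rewrite scaleN1r opprB [RHS]addrC addrA subrK.
Qed.

(** Finite generation gives the ascending chain condition: the union of a
    strictly increasing chain would be generated by finitely many elements,
    which already lie in one of its members. *)
Lemma maximal_submodule (F : submodClosed M -> Prop) :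
  noetherian_module -> (exists N, F N) ->
  exists2 N, F N & forall N', F N' -> {subset N <= N'} -> {subset N' <= N}.
Proof.
move=> noeth [N0 FN0]; apply: contrapT => noMax.
pose T := {N : submodClosed M | F N}.
have /choice[f fP] : forall N : T, exists N' : T,
    {subset sval N <= sval N'} /\ ~ {subset sval N' <= sval N}.
  move=> [N FN]; apply: contrapT => h; apply: noMax; exists N => // N' FN' NN'.
  by apply: contrapT => N'N; apply: h; exists (exist _ N' FN').
pose C k := sval (iter k f (exist _ N0 FN0 : T)).
have C_S k : {subset C k <= C k.+1} /\ ~ {subset C k.+1 <= C k} by exact: fP.
have C_le k l : (k <= l)%N -> {subset C k <= C l}.
  move=> /subnK <-; elim: (l - k)%N => [|d IH] // x /IH.
  exact: (C_S (d + k)%N).1.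
have [U memU] : exists U : submodClosed M,
    forall x, x \in U <-> exists k, x \in C k.
  apply: submodule_comprehension => [|a x y [k xk] [l yl]].
    by exists 0%N; exact: rpred0.
  exists (maxn k l); apply: rpredD; last exact: C_le (leq_maxr k l) _ yl.
  exact/rpredZ/(C_le _ _ (leq_maxl k l)).
have [s [sU genU]] := noeth U.
have [k sk] : exists k, {subset s <= C k}.
  elim: s sU {genU} => [|x s IH] sU; first by exists 0%N.
  have [k sk] := IH (fun y ys => sU y (mem_behead (s := x :: s) ys)).
  have /memU[l xl] := sU x (mem_head x s).
  exists (maxn k l) => y; rewrite inE => /predU1P[->|/sk].
    exact: C_le (leq_maxr k l) _ xl.
  exact: C_le (leq_maxl k l) _.
have [_] := C_S k; apply=> x xk; apply: (genU (C k)) => //.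
by apply/memU; exists k.+1.
Qed.

End Noetherian.

(** * Irreducible submodules and their primes *)

Section Irreducible.
Variables (R : comPzRingType) (M : lmodType R).
Implicit Types (Q : submodClosed M) (p q : spec R).

Lemma irreducible_capP Q (N1 N2 : submodClosed M) :
    irreducible_sub Q -> {subset Q <= N1} -> {subset Q <= N2} ->
    (forall x, x \in N1 -> x \in N2 -> x \in Q) ->
  {subset N1 <= Q} \/ {subset N2 <= Q}.
Proof.
move=> irrQ QN1 QN2 N12Q; apply: contrapT => /not_orP[N1Q N2Q].
apply: irrQ; exists N1, N2; split; [by split..|].
apply/seteqP; split=> x /= => [xQ|[]]; last exact: N12Q.
by split; [exact: QN1|exact: QN2].
Qed.

(** M / Q is uniform: otherwise Q would be the intersection of Q + R x and
    Q + R y. *)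
Lemma irreducible_uniform Q x y :
    irreducible_sub Q -> x \notin Q -> y \notin Q ->
  exists b c, b *: x - c *: y \in Q /\ b *: x \notin Q.
Proof.
move=> irrQ xQ yQ; apply: contrapT => noMeet.
have adjoin (w : M) : exists N : submodClosed M,
    forall v, v \in N <-> exists a, v - a *: w \in Q.
  apply: submodule_comprehension => [|a u v [b ub] [c vc]].
    by exists 0; rewrite scale0r subr0 rpred0.
  exists (a * b + c).
  suff -> : a *: u + v - (a * b + c) *: w = a *: (u - b *: w) + (v - c *: w).
    by rewrite rpredD // rpredZ.
  by rewrite scalerBr scalerA scalerDl opprD addrACA.
have sub_adjoin (N : submodClosed M) w :
    (forall v, v \in N <-> exists a, v - a *: w \in Q) ->
    {subset Q <= N} /\ w \in N.
  move=> memN; split=> [v vQ|]; apply/memN.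
    by exists 0; rewrite scale0r subr0.
  by exists 1; rewrite scale1r subrr rpred0.
have [[X memX] [Y memY]] := (adjoin x, adjoin y).
have [[QX xX] [QY yY]] := (sub_adjoin X x memX, sub_adjoin Y y memY).
have [] // := @irreducible_capP Q X Y irrQ QX QY.
- move=> v /memX[b vb] /memY[c vc]; apply/negP => /negP vQ.
  apply: noMeet; exists b, c; split.
    suff -> : b *: x - c *: y = (v - c *: y) - (v - b *: x).
      exact: mem_subB.
    by rewrite opprB [RHS]addrC addrA subrK.
  apply: contra vQ => bxQ; apply: (mem_subDl (N := Q) (x := - (b *: x))).
    by rewrite -scaleN1r rpredZ.
  by rewrite addrC.
- by move=> /(_ x xX) xQ'; rewrite xQ' in xQ.
- by move=> /(_ y yY) yQ'; rewrite yQ' in yQ.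
Qed.

Definition nilpotent_mod Q (a : R) : Prop :=
  exists n, forall x, a ^+ n *: x \in Q.

Definition regular_mod Q (a : R) : Prop :=
  forall x, a *: x \in Q -> x \in Q.

Lemma regular_modX Q a n : regular_mod Q a -> regular_mod Q (a ^+ n).
Proof.
move=> reg; elim: n => [|n IH] x; first by rewrite scale1r.
by rewrite exprS -scalerA => /reg/IH.
Qed.

(** Fitting's argument: once the submodules (Q : a^n) have become stationary,
    Q is the intersection of (Q : a^n) and a^n M + Q. *)
Lemma nilpotent_or_regular Q a :
  noetherian_module M -> irreducible_sub Q ->
  nilpotent_mod Q a \/ regular_mod Q a.
Proof.
move=> noeth irrQ.
have colon n : exists N : submodClosed M,
    forall x, x \in N <-> a ^+ n *: x \in Q.
  apply: submodule_comprehension => [|b x y ax ay].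
    by rewrite scaler0 rpred0.
  by rewrite scalerDr scalerA mulrC -scalerA rpredD // rpredZ.
have [|N [n memN] maxN] := @maximal_submodule R M
    (fun N => exists n, forall x, x \in N <-> a ^+ n *: x \in Q) noeth.
  by have [N memN] := colon 0%N; exists N, 0%N.
have stable k x : a ^+ (k + n) *: x \in Q -> x \in N.
  have [N' memN'] := colon (k + n)%N; move=> xQ.
  apply: (maxN N'); [by exists (k + n)%N| |exact/memN'].
  by move=> y /memN yQ; apply/memN'; rewrite exprD -scalerA rpredZ.
have [P memP] : exists P : submodClosed M,
    forall x, x \in P <-> exists m, x - a ^+ n *: m \in Q.
  apply: submodule_comprehension => [|b x y [k xk] [l yl]].
    by exists 0; rewrite scaler0 subr0 rpred0.
  exists (b *: k + l).
  suff -> : b *: x + y - a ^+ n *: (b *: k + l)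
      = b *: (x - a ^+ n *: k) + (y - a ^+ n *: l) by rewrite rpredD // rpredZ.
  by rewrite scalerBr !scalerDr !scalerA mulrC opprD addrACA.
have [x xQ|x xQ|x /memN xQ /memP[m xm]|NQ|PQ] :=
    @irreducible_capP Q N P irrQ.
- by apply/memN; rewrite rpredZ.
- by apply/memP; exists 0; rewrite scaler0 subr0.
- rewrite -[x](subrK (a ^+ n *: m)) rpredD //.
  apply/memN/(stable n); rewrite exprD -scalerA.
  rewrite -[_ *: m](subKr x) scalerBr; apply: mem_subB => //.
  by rewrite rpredZ.
- by right=> x xQ; apply/NQ/(stable 1%N); rewrite exprS mulrC -scalerA rpredZ.
- by left; exists n => x; apply/PQ/memP; exists x; rewrite subrr rpred0.
Qed.

(** Multiplying x in turn by the last power of each element of s that does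
    not send it into Q. *)
Lemma nilpotent_killer Q (s : seq R) x :
    (forall a, a \in s -> nilpotent_mod Q a) -> x \notin Q ->
  exists2 c, c *: x \notin Q & forall a, a \in s -> a *: (c *: x) \in Q.
Proof.
elim: s => [|a s IH] nil_s xQ; first by exists 1; rewrite ?scale1r.
have [b bs|c cxQ ks] := IH _ xQ; first by apply: nil_s; rewrite inE bs orbT.
have [n an] := nil_s a (mem_head a s).
have ex_n : exists n, a ^+ n *: (c *: x) \in Q by exists n; exact: an.
have [[|m] amQ min_m] := ex_minnP ex_n.
  by move: amQ; rewrite scale1r => cxQ'; rewrite cxQ' in cxQ.
exists (a ^+ m * c) => [|b].
  by apply/negP; rewrite -scalerA => /min_m; rewrite ltnn.
rewrite -scalerA inE => /predU1P[->|/ks bQ].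
  by rewrite (scalerA a) -exprS.
by rewrite (scalerA b) mulrC -scalerA rpredZ.
Qed.

Lemma nilpotent_not_regular Q a x :
  x \notin Q -> nilpotent_mod Q a -> ~ regular_mod Q a.
Proof.
by move=> xQ [n an] /(@regular_modX _ _ n)/(_ x (an x)) xQ'; rewrite xQ' in xQ.
Qed.

(** For proper Q this determines p as the radical of the annihilator of M / Q
    and says that Q is primary. *)
Definition prime_of Q p : Prop :=
  (forall a, a \in p -> nilpotent_mod Q a) /\
  (forall a, a \notin p -> regular_mod Q a).

(** Nilpotent elements are closed under addition because two of them kill a
    common nonzero element of M / Q, so that their sum cannot be regular. *)
Lemma irreducible_prime Q x :
    noetherian_module M -> irreducible_sub Q -> x \notin Q ->
  exists p, prime_of Q p.
Proof.
move=> noeth irrQ xQ; have dich a := nilpotent_or_regular a noeth irrQ.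
have notreg a := @nilpotent_not_regular Q a x xQ.
pose I : {pred R} := fun a => `[< nilpotent_mod Q a >].
suff primeI : prime_ideal I.
  exists (Spec primeI); split=> a; first by move/asboolP.
  by move=> /negP aI; case: (dich a) => // /asboolP.
split; [split| |] => [|c a b /asboolP nila /asboolP nilb| |a b /asboolP nilab].
- by apply/asboolP; exists 1%N => y; rewrite scale0r rpred0.
- apply/asboolP; case: (dich (c * a + b)) => // reg.
  have [|d dxQ kd] := @nilpotent_killer Q [:: a; b] x _ xQ.
    by move=> e; rewrite !inE => /pred2P[]->.
  suff /reg dxQ' : (c * a + b) *: (d *: x) \in Q by rewrite dxQ' in dxQ.
  rewrite scalerDl -(scalerA c); apply: rpredD; first apply: rpredZ;
    by apply: kd; rewrite !inE eqxx ?orbT.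
- by apply/negP => /asboolP /notreg; apply=> y; rewrite scale1r.
- have [|rega] := dich a; first by left; apply/asboolP.
  have [|regb] := dich b; first by right; apply/asboolP.
  by case: (notreg _ nilab) => y; rewrite -scalerA => /rega/regb.
Qed.

Lemma spec_generators p : noetherian R ->
  exists2 s : seq R, {subset s <= p} &
    forall P : R -> Prop, P 0 -> (forall a b c, P b -> P c -> P (a * b + c)) ->
      (forall a, a \in s -> P a) -> forall a, a \in p -> P a.
Proof.
move=> hR; have [|a b c bp cp|I memI] := @ideal_comprehension R (fun a => a \in p).
- exact: spec0.
- by rewrite specD // specM.
have [s [sI genI]] : exists s : seq R^o, generates s I.
  exact: finitely_generatedP (hR I).
exists s => [a /sI/memI//|P P0 Plin Ps a ap].
have [J memJ] := ideal_comprehension P0 Plin.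
by apply/memJ/genI; [move=> b bs; apply/memJ/Ps | apply/memI].
Qed.

Lemma spec_notinM p a b : a \notin p -> b \notin p -> a * b \notin p.
Proof.
move=> ap bp; apply/negP; case: (spec_prime p) => _ _ /[apply] -[] h.
  by rewrite h in ap.
by rewrite h in bp.
Qed.

Lemma spec_notin1 p : 1 \notin p.
Proof. by case: (spec_prime p). Qed.

Lemma spec_notinX p a n : a \notin p -> a ^+ n \notin p.
Proof.
move=> ap; elim: n => [|n IH]; first exact: spec_notin1.
by rewrite exprS spec_notinM.
Qed.

Lemma spec_notin_prod p (I : Type) (r : seq I) (P : pred I) (f : I -> R) :
  (forall i, f i \notin p) -> \prod_(i <- r | P i) f i \notin p.
Proof.
move=> fp; elim/big_ind: _ => //; first exact: spec_notin1.
exact: spec_notinM.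
Qed.

Lemma prime_of_killed Q p x : noetherian R -> prime_of Q p -> x \notin Q ->
  exists2 c, c *: x \notin Q & forall a, a \in p -> a *: (c *: x) \in Q.
Proof.
move=> hR [nilp _] xQ; have [s sp genp] := spec_generators p hR.
have [a /sp/nilp//|c cxQ ks] := @nilpotent_killer Q s x _ xQ.
exists c => //; apply: genp => //; first by rewrite scale0r rpred0.
by move=> a b d bQ dQ; rewrite scalerDl -(scalerA a) rpredD // rpredZ.
Qed.

(** The reason socles can be computed one irreducible component at a time:
    up to a multiplier outside p, an element of M / Q killed by p is a multiple
    of the given element z if p is the prime q of Q, and 0 otherwise.  When p
    is properly contained in q, the multiplier is a power of an element of q
    outside p. *)
Lemma killed_mod_irreducible Q p q x z :
    irreducible_sub Q -> prime_of Q q -> z \notin Q ->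
    (forall a, a \in p -> a *: x \in Q) ->
  exists bc : R * R, [/\ bc.1 \notin p, bc.1 *: x - bc.2 *: z \in Q &
                         q <> p -> bc.2 = 0].
Proof.
move=> irrQ [nilq regq] zQ px; case: (boolP (x \in Q)) => [xQ|xQ].
  by exists (1, 0); split; rewrite ?spec_notin1 ?scale1r ?scale0r ?subr0.
have pq a : a \in p -> a \in q.
  by move=> ap; apply: contraNT xQ => /regq; apply; exact: px.
have [qp|qp] := pselect (q = p).
  have [b [c [bcQ bxQ]]] := irreducible_uniform irrQ xQ zQ.
  by exists (b, c); split=> //=; apply: contra bxQ; exact: px.
have [s sq sp] : exists2 s, s \in q & s \notin p.
  apply: contrapT => nos; apply: qp; apply: spec_ext => a.
  apply/idP/idP => [aq|/pq//]; apply/negPn/negP => ap.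
  by apply: nos; exists a.
have [n sn] := nilq s sq; exists (s ^+ n, 0); split=> //=.
  exact: spec_notinX.
by rewrite scale0r subr0.
Qed.

End Irreducible.

(** * Irredundant irreducible decompositions *)

Section Decomposition.
Variables (R : comPzRingType) (M : lmodType R).
Implicit Types (N : submodClosed M) (T : finType) (p : spec R).

(** Irredundance is expressed by the elements from which bases of the socles are
    built.  Arbitrary finite index types allow passing to the components with a
    given prime, which are indexed by a subtype. *)
Definition irr_decomposition T N (Q : T -> submodClosed M) : Prop :=
  [/\ forall i, irreducible_sub (Q i),
      forall x, x \in N <-> forall i, x \in Q i &
      forall j, exists2 y, y \notin Q j & forall i, i != j -> y \in Q i].

Lemma irr_decompositionP n N (Q : 'I_n -> submodClosed M) :
  irredundant_irreducible_decomposition N Q <-> irr_decomposition N Q.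
Proof.
have memN : [set` N] = \bigcap_i [set` Q i] <->
    forall x, x \in N <-> forall i, x \in Q i.
  split=> [NQ x|NQ].
    split=> [xN i|xQ].
      have : [set` N] x by [].
      by rewrite NQ; apply.
    suff : [set` N] x by [].
    by rewrite NQ => i _; exact: xQ.
  apply/seteqP; split=> x /= => [/NQ xQ i _|xQ]; first exact: xQ.
  by apply/NQ => i; exact: xQ.
split=> [[irrQ /(memN.1) NQ irred]|[irrQ NQ irred]]; split=> //; last 2 first.
- exact/(memN.2).
- move=> j Nj; have [y yQj yQ] := irred j.
  have : [set` N] y by rewrite Nj => i /= /eqP; exact: yQ.
  by move=> /NQ/(_ j) yQj'; rewrite yQj' in yQj.
move=> j; apply: contrapT => noy; apply: (irred j); apply/seteqP.
split=> x /= => [/NQ xQ i _|xQ]; first exact: xQ.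
apply/NQ => i; case: (eqVneq i j) => [->|/eqP]; last exact: xQ.
apply/negPn/negP => xQj; apply: noy; exists x => // k /eqP; exact: xQ.
Qed.

(** The prime of each component, and an element of M whose class generates a
    copy of R / p i in M / N that embeds in M / Q i. *)
Record socle_frame T N (Q : T -> submodClosed M) (p : T -> spec R) (z : T -> M)
    : Prop := SocleFrame {
  frame_irr : forall i, irreducible_sub (Q i);
  frame_mem : forall x, x \in N <-> forall i, x \in Q i;
  frame_prime : forall i, prime_of (Q i) (p i);
  frame_notin : forall i, z i \notin Q i;
  frame_killed : forall i a, a \in p i -> a *: z i \in Q i;
  frame_in : forall i j, i != j -> z i \in Q j
}.

Lemma irr_decomposition_frame T N (Q : T -> submodClosed M) :
    noetherian R -> noetherian_module M -> irr_decomposition N Q ->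
  exists (p : T -> spec R) (z : T -> M), socle_frame N Q p z.
Proof.
move=> hR hM [irrQ NQ irred].
have /choice[pz pzP] : forall i, exists pz : spec R * M,
    [/\ prime_of (Q i) pz.1, pz.2 \notin Q i,
        forall a, a \in pz.1 -> a *: pz.2 \in Q i &
        forall j, i != j -> pz.2 \in Q j].
  move=> i; have [y yQi yQ] := irred i.
  have [p pQ] := irreducible_prime hM (irrQ i) yQi.
  have [c cyQ py] := prime_of_killed hR pQ yQi.
  by exists (p, c *: y); split=> // j ij; rewrite rpredZ // yQ // eq_sym.
by exists (fun i => (pz i).1), (fun i => (pz i).2); split=> // i; case: (pzP i).
Qed.

Section Frame.
Variables (T : finType) (N : submodClosed M) (Q : T -> submodClosed M).
Variables (p : T -> spec R) (z : T -> M).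
Hypothesis frame : socle_frame N Q p z.

Lemma frame_mulz i a : a *: z i \in Q i <-> a \in p i.
Proof.
split=> [az|/(frame_killed frame)//]; apply/negPn/negP.
move=> /(frame_prime frame i).2/(_ _ az) zQ.
by have := frame_notin frame i; rewrite zQ.
Qed.

(** Modulo Q (e j) only the term of index j survives. *)
Lemma frame_independent (U : finType) (e : U -> T) (c : U -> R) :
    injective e -> \sum_u c u *: z (e u) \in N ->
  forall u, c u \in p (e u).
Proof.
move=> inj_e /(frame_mem frame) cN j; apply/frame_mulz.
have := cN (e j); rewrite (bigD1 j) //= addrC; apply: mem_subDl.
by apply: rpred_sum => i ij; rewrite rpredZ // (frame_in frame) //
  (inj_eq inj_e).
Qed.

Lemma frame_ann i a : a *: z i \in N <-> a \in p i.
Proof.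
split=> [/(frame_mem frame)/(_ i)/frame_mulz //|ap]; apply/(frame_mem frame) => j.
have [<-|ij] := eqVneq i j; first exact/frame_mulz.
by rewrite rpredZ // (frame_in frame).
Qed.

(** The z i with p i = q span the q-socle of M / N up to denominators: solve
    for the coefficients in each M / Q i separately and multiply by the
    multipliers of all the other components. *)
Lemma frame_span (q : spec R) x :
    (forall a, a \in q -> a *: x \in N) ->
  exists b c, [/\ b \notin q, forall i, p i <> q -> c i = 0 &
                  b *: x - \sum_i c i *: z i \in N].
Proof.
move=> qx.
have /choice[bc bcP] : forall i, exists bc : R * R,
    [/\ bc.1 \notin q, bc.1 *: x - bc.2 *: z i \in Q i &
        p i <> q -> bc.2 = 0].
  move=> i; apply: killed_mod_irreducible.
  - exact: (frame_irr frame).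
  - exact: (frame_prime frame).
  - exact: (frame_notin frame).
  - by move=> a /qx/(frame_mem frame).
pose B i := \prod_(k | k != i) (bc k).1.
exists (\prod_i (bc i).1), (fun i => B i * (bc i).2); split.
- by apply: spec_notin_prod => i; case: (bcP i).
- by move=> i pq; case: (bcP i) => _ _ ->; rewrite ?mulr0.
apply/(frame_mem frame) => i; rewrite (bigD1 i) //= [\sum_i _](bigD1 i) //=.
rewrite opprD addrA mem_subB //; last first.
  by apply: rpred_sum => j ji; rewrite rpredZ // (frame_in frame).
rewrite mulrC -!scalerA -scalerBr rpredZ //.
by case: (bcP i).
Qed.

Lemma mpi_eq0 x : mpi N x = 0 <-> x \in N.
Proof.
have <- : mpi N 0 = 0 by exact: raddf0.
by rewrite mpi_eq subr0.
Qed.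

Lemma frame_Ass : Ass (mquot N) = range p.
Proof.
apply/seteqP; split=> q /= => [[w wP]|[i _ <-]]; last first.
  by exists (mpi N (z i)) => a; rewrite -mpiZ mpi_eq0 frame_ann.
apply: contrapT => pq.
have [x wx] : exists x, w = mpi N x by exists (repr w); rewrite mpiK.
have annx a : a \in q <-> a *: x \in N by rewrite wP wx -mpiZ mpi_eq0.
have [b [c [bq c0]]] := @frame_span q x (fun a aq => (annx a).1 aq).
rewrite big1 => [|i _]; last first.
  by rewrite c0 ?scale0r // => piq; apply: pq; exists i.
by rewrite subr0 => /annx bq'; rewrite bq' in bq.
Qed.

End Frame.
End Decomposition.

(** * Socles of localizations *)

Section BasisSize.
Variables (K : fieldType) (V : lmodType K).

Lemma basis_size_le n m (b : 'I_n -> V) (b' : 'I_m -> V) :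
  is_basis b -> is_basis b' -> (n <= m)%N.
Proof.
move=> bP b'P.
have /choice[A AP] : forall i, exists c : 'rV[K]_m,
    b i = \sum_(j < m) c 0 j *: b' j.
  by move=> i; have [c [? _]] := b'P (b i); exists c.
have /choice[B BP] : forall j, exists c : 'rV[K]_n,
    b' j = \sum_(k < n) c 0 k *: b k.
  by move=> j; have [c [? _]] := bP (b' j); exists c.
pose mA := \matrix_(i < n) A i; pose mB := \matrix_(j < m) B j.
apply: (@mulmx1_min _ n m mA mB); apply/row_matrixP => i.
have [c [_ uniq_c]] := bP (b i).
transitivity c; last first.
  apply: uniq_c; rewrite (bigD1 i) //= !mxE eqxx scale1r big1 ?addr0 // => k ki.
  by rewrite !mxE eq_sym (negPf ki) scale0r.
apply/esym/uniq_c; rewrite {1}AP.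
under eq_bigr => j _ do rewrite BP scaler_sumr.
rewrite exchange_big; apply: eq_bigr => k _ /=.
rewrite !mxE scaler_suml; apply: eq_bigr => j _.
by rewrite !mxE scalerA.
Qed.

Lemma vdimE n (b : 'I_n -> V) : is_basis b -> vdim V = n.
Proof.
move=> bP; have [b' b'P] : exists b' : 'I_(vdim V) -> V, is_basis b'.
  apply: (@xgetPex _ 0%N [set n | exists b : 'I_n -> V, is_basis b]).
  by exists n, b.
by apply/eqP; rewrite eqn_leq (basis_size_le b'P bP) (basis_size_le bP b'P).
Qed.

End BasisSize.

Section SocleBasis.
Variables (R : comPzRingType) (q : spec R).

Definition residue_frac (a : R) (s : denom q) : residue q :=
  \pi_({ideal_quot locmax q}) (frac (a : R^o) s : locring q).

Lemma residue_frac_eq0 (a : R) s :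
  a \in q -> residue_frac a s = 0.
Proof.
move=> aq; transitivity (\pi_({ideal_quot locmax q}) (0 : locring q)).
  2: exact: rmorph0.
apply/eqP; rewrite -Quotient.idealrBE subr0; apply/asboolP.
by exists a, s.
Qed.

Lemma residue_common_denom n (f : 'rV[residue q]_n) :
  exists (a : 'I_n -> R) (s : denom q), forall i,
    f 0 i = residue_frac (a i) s.
Proof.
pose l i : locring q := repr (f 0 i : {ideal_quot locmax q}).
have sq : \prod_(i < n) sval (den (l i)) \notin q.
  by apply: spec_notin_prod => i; exact: valP (den (l i)).
pose a i : R := num (l i) * \prod_(k < n | k != i) sval (den (l k)).
exists a, (exist (fun s => is_true (s \notin q)) _ sq) => i; rewrite -[LHS]reprK.
congr (\pi_({ideal_quot locmax q}) _).
rewrite -[repr _](frac_numden (l i)); apply/frac_eq; exists (denom1 q).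
rewrite /= scale1r; apply/eqP; rewrite subr_eq0; apply/eqP.
rewrite (bigD1 i) //= /a.
set P := \prod_(k < n | k != i) _.
rewrite -[LHS]/(sval (den (l i)) * P * (num (l i) : R)).
rewrite -[RHS]/(sval (den (l i)) * ((num (l i) : R) * P)).
by rewrite -mulrA; congr (_ * _); exact: mulrC.
Qed.

Variable L : lmodType R.

Lemma frac_eq0 (x : L) (s : denom q) :
  frac x s = 0 <-> exists2 u : R, u \notin q & u *: x = 0.
Proof.
rewrite -[0]/(frac 0 (denom1 q)) frac_eq; split=> [[[u uq]]|[u uq ux]].
  by rewrite /= scale1r scaler0 subr0 => ux; exists u.
exists (exist (fun s => is_true (s \notin q)) u uq).
by rewrite /= scale1r scaler0 subr0.
Qed.

Lemma frac_sum n (x : 'I_n -> L) (s : denom q) :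
  \sum_(i < n) frac (x i) s = frac (\sum_(i < n) x i) s.
Proof.
elim/big_ind2: _ => // [|y1 x1 y2 x2 -> ->].
  by apply/esym/frac_eq0; exists 1; rewrite ?spec_notin1 ?scaler0.
rewrite fracD; apply/frac_eq; exists (denom1 q); rewrite scale1r /=.
by rewrite -scalerDr scalerA subrr.
Qed.

Lemma socle_mem_frac (x : L) s : (forall a, a \in q -> a *: x = 0) ->
  frac x s \in killed_by (locmax q) (L := localization q L).
Proof.
move=> qx; apply/asboolP => _ /asboolP[a [t [aq ->]]].
rewrite fracZ qx //; apply/frac_eq0.
by exists 1; rewrite ?spec_notin1 ?scaler0.
Qed.

Definition socle_of (x : L) (qx : forall a, a \in q -> a *: x = 0)
    : socle q L :=
  exist _ (frac x (denom1 q)) (socle_mem_frac (denom1 q) qx).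

Lemma socle_comb n (x : 'I_n -> L) (qx : forall i a, a \in q -> a *: x i = 0)
    (c : 'rV[residue q]_n) (a : 'I_n -> R) (s : denom q) :
    (forall i, c 0 i = residue_frac (a i) s) ->
  sval (\sum_(i < n) c 0 i *: socle_of (qx i))
    = frac (\sum_(i < n) a i *: x i) s.
Proof.
move=> ca.
transitivity (\sum_(i < n) sval (c 0 i *: socle_of (qx i))).
  exact: (big_morph (fun y : socle q L => sval y)).
rewrite -frac_sum; apply: eq_bigr => i _; rewrite ca socleZ fracZ.
by apply: eq_frac => //=; rewrite mulr1.
Qed.

(** An element x / s of the socle can be written with a numerator killed
    by q itself, since finitely many multipliers take care of q. *)
Lemma socle_fracP (v : socle q L) : noetherian R ->
  exists x s, sval v = frac x s /\ forall a, a \in q -> a *: x = 0.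
Proof.
move=> hR; have [g gq geng] := spec_generators q hR.
move: (svalP v) => /asboolP; rewrite -(frac_numden (sval v)).
move: (num (sval v)) (den (sval v)) => x s vq.
have killed a : a \in q -> exists2 u, u \notin q & u *: (a *: x) = 0.
  move=> aq; have : frac (a : R^o) (denom1 q) \in locmax q.
    by apply/asboolP; exists a, (denom1 q).
  by move=> /vq; rewrite fracZ => /frac_eq0.
have [u uq ug] : exists2 u, u \notin q & forall a, a \in g -> u *: (a *: x) = 0.
  elim: g gq {geng} => [|a g IH] gq; first by exists 1; rewrite ?spec_notin1.
  have [u uq ug] := IH (fun b bg => gq b (mem_behead (s := a :: g) bg)).
  have [w wq wa] := killed a (gq a (mem_head a g)).
  exists (u * w) => [|b]; first exact: spec_notinM.
  rewrite inE => /predU1P[->|/ug ub]; first by rewrite -scalerA wa scaler0.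
  by rewrite mulrC -scalerA ub scaler0.
exists (u *: x), (denomM (exist (fun s => is_true (s \notin q)) u uq) s); split.
  apply/frac_eq; exists (denom1 q); rewrite scale1r /= scalerA [sval s * _]mulrC.
  exact: subrr.
apply: geng => [|a b c bx cx|a /ug]; first by rewrite scale0r.
  by rewrite scalerDl -(scalerA a) bx cx scaler0 addr0.
by rewrite !scalerA mulrC.
Qed.

End SocleBasis.

Section FrameBasis.
Variables (R : comPzRingType) (M : lmodType R) (T : finType).
Variables (N : submodClosed M) (Q : T -> submodClosed M).
Variables (p : T -> spec R) (z : T -> M).
Hypotheses (hR : noetherian R) (frame : socle_frame N Q p z).

(** The basis consists of the fractions z i / 1 with p i = q: [frame_span] and
    [frame_independent] survive localization once numerators killed by q and a
    common denominator have been chosen. *)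
Lemma frame_basis q :
  exists b : 'I_#|[pred i | p i == q]| -> socle q (mquot N), is_basis b.
Proof.
set A := [pred i | p i == q]; pose e (k : 'I_#|A|) : T := enum_val k.
have pe k : p (e k) = q by apply/eqP; exact: (enum_valP k).
have qz k a : a \in q -> a *: mpi N (z (e k)) = 0.
  by move=> aq; rewrite -mpiZ; apply/mpi_eq0/(frame_ann frame); rewrite pe.
have mpi_sum n (c : 'I_n -> R) (y : 'I_n -> M) :
    \sum_i c i *: mpi N (y i) = mpi N (\sum_i c i *: y i).
  rewrite (big_morph (mpi N) (@mpiD _ _ N) (raddf0 _)).
  by apply: eq_bigr => i _; rewrite mpiZ.
pose b k := socle_of (qz k); exists b => v.
have indep (d : 'rV_#|A|) : \sum_i d 0 i *: b i = 0 -> d = 0.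
  have [a [s das]] := residue_common_denom d.
  move=> /(congr1 sval); rewrite (socle_comb qz das) => /frac_eq0[u uq].
  rewrite mpi_sum -mpiZ mpi_eq0 scaler_sumr => uN.
  apply/rowP => k; rewrite das mxE; apply: residue_frac_eq0.
  have := frame_independent frame (c := fun k => u * a k)
    (enum_val_inj : injective e).
  under eq_bigr => i _ do rewrite -scalerA.
  move=> /(_ uN k); rewrite pe; apply: contraLR; exact: spec_notinM.
have [w [s [vE qw]]] := socle_fracP v hR.
have [x wx] : exists x, w = mpi N x by exists (repr w); rewrite mpiK.
have [|c0 [c [cq c_eq0 cN]]] := frame_span frame (q := q) (x := x).
  by move=> a /qw; rewrite wx -mpiZ mpi_eq0.
pose t : denom q := denomM (exist (fun s => is_true (s \notin q)) c0 cq) s.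
pose d : 'rV[residue q]_#|A| := \row_k residue_frac (c (e k)) t.
have vd : v = \sum_i d 0 i *: b i.
  apply: val_inj; rewrite /= (socle_comb (a := c \o e) (s := t) qz); last first.
    by move=> k; rewrite mxE.
  rewrite vE mpi_sum /comp /e -(big_enum_val (fun i => c i *: z i)) wx.
  have -> : \sum_(i in A) c i *: z i = \sum_i c i *: z i.
    rewrite big_mkcond; apply: eq_bigr => i _; rewrite inE.
    by case: eqP => // /c_eq0 ->; rewrite scale0r.
  have <- : mpi N (c0 *: x) = mpi N (\sum_i c i *: z i) by apply/mpi_eq.
  apply/frac_eq; exists (denom1 q); rewrite scale1r /= mpiZ scalerA.
  by rewrite [sval s * _]mulrC subrr.
move: d vd => d vd; exists d; split=> // d' vd'.
apply/eqP; rewrite -subr_eq0; apply/eqP.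
have dB k : (d - d') 0 k = d 0 k - d' 0 k by rewrite !mxE.
apply: indep; under eq_bigr => i _ do rewrite dB scalerBl.
by rewrite sumrB -vd -vd' subrr.
Qed.

End FrameBasis.

(** * Counting the components *)

Section Index.
Variables (R : comPzRingType) (M : lmodType R).
Hypotheses (hR : noetherian R) (hM : noetherian_module M).
Implicit Types (N : submodClosed M) (T : finType).

Lemma frame_vdim T N (Q : T -> submodClosed M) p z q :
  socle_frame N Q p z -> vdim (socle q (mquot N)) = #|[pred i | p i == q]|.
Proof. by move=> /(frame_basis hR)/(_ q)[b]; exact: vdimE. Qed.

Lemma frame_finite_dimensional T N (Q : T -> submodClosed M) p z q :
  socle_frame N Q p z -> finite_dimensional (socle q (mquot N)).
Proof. by move=> /(frame_basis hR)/(_ q); exists #|[pred i | p i == q]|. Qed.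

(** Each component contributes 1 to the socle at its own prime and 0 to the
    others. *)
Lemma frame_card T N (Q : T -> submodClosed M) p z :
    socle_frame N Q p z ->
  (\sum_(q \in Ass (mquot N)) vdim (socle q (mquot N)))%N = #|T|.
Proof.
move=> frame; rewrite (frame_Ass frame).
under eq_fsbigr => q _ do rewrite (frame_vdim q frame).
have -> : range p = [set` undup (codom p)].
  apply/seteqP; split=> q /=; rewrite mem_undup.
    by case=> i _ <-; exact: codom_f.
  by move=> /codomP[i ->]; exists i.
rewrite -fsbig_seq ?undup_uniq //.
under eq_bigr => q _ do rewrite -sum1_card big_mkcond /=.
rewrite exchange_big -sum1_card; apply: eq_bigr => i _ /=.
rewrite (bigD1_seq (p i)) ?mem_undup ?codom_f ?undup_uniq //= inE eqxx.
by rewrite big1 // => q qi; rewrite inE eq_sym (negPf qi).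
Qed.

Lemma frame_irr_decomposition T N (Q : T -> submodClosed M) p z :
  socle_frame N Q p z -> irr_decomposition N Q.
Proof.
move=> frame; split; [exact: frame_irr frame|exact: frame_mem frame|].
move=> j; exists (z j); first exact: (frame_notin frame).
by move=> i ij; rewrite (frame_in frame) // eq_sym.
Qed.

Lemma irr_decomposition_enum T N (Q : T -> submodClosed M) :
    irr_decomposition N Q ->
  irr_decomposition N (fun k : 'I_#|T| => Q (enum_val k)).
Proof.
move=> [irrQ NQ irred]; split=> [k|x|j].
- exact: irrQ.
- by rewrite NQ; split=> h i; [exact: h|rewrite -(enum_rankK i); exact: h].
have [y yQ yQ'] := irred (enum_val j); exists y => // i ij.
by apply: yQ'; rewrite (inj_eq enum_val_inj).
Qed.

(** Noether's theorem on the number of components: it is the number computed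
    from the socles, in which the decomposition does not occur. *)
Lemma irr_decomposition_index T N (Q : T -> submodClosed M) :
  irr_decomposition N Q -> index_of_reducibility N #|T|.
Proof.
move=> dec; split.
  exists (fun k => Q (enum_val k)); apply/irr_decompositionP.
  exact: irr_decomposition_enum.
move=> m Q' /irr_decompositionP dec'.
have [p [z frame]] := irr_decomposition_frame hR hM dec.
have [p' [z' frame']] := irr_decomposition_frame hR hM dec'.
by rewrite -(frame_card frame) (frame_card frame') card_ord.
Qed.

Lemma exists_irreducible_decomposition N :
  exists T (Q : T -> submodClosed M),
    (forall i, irreducible_sub (Q i)) /\
    forall x, x \in N <-> forall i, x \in Q i.
Proof.
pose D N := exists T (Q : T -> submodClosed M),
    (forall i, irreducible_sub (Q i)) /\
    forall x, x \in N <-> forall i, x \in Q i.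
apply: contrapT => notD.
have [|{notD}N notD maxN] := @maximal_submodule R M (fun N => ~ D N) hM.
  by exists N.
have larger (N' : submodClosed M) : [set` N] `<` [set` N'] -> D N'.
  move=> [NN' N'N]; apply: contrapT => notD'; apply: N'N.
  by move=> x; apply: (maxN N').
have [irrN|/contrapT[N1 [N2 [/larger[T1 [Q1 [irr1 mem1]]]
    /larger[T2 [Q2 [irr2 mem2]]] N12]]]] := pselect (irreducible_sub N).
  apply: notD; exists unit, (fun=> N); split=> // x.
  by split=> [//|]; apply; exact: tt.
apply: notD; exists (T1 + T2)%type.
exists (fun i => match i with inl i1 => Q1 i1 | inr i2 => Q2 i2 end).
split=> [[]//|x]; have -> : (x \in N) = ((x \in N1) && (x \in N2)).
  have e : [set` N] x = ([set` N1] x /\ [set` N2] x) by rewrite N12.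
  by apply/idP/andP; rewrite /= in e; rewrite e.
split=> [/andP[/mem1 x1 /mem2 x2] []//|xQ].
by apply/andP; split; [apply/mem1 => i; exact: xQ (inl i)|
                       apply/mem2 => i; exact: xQ (inr i)].
Qed.

(** A decomposition with the least number of components is irredundant. *)
Lemma exists_irr_decomposition N :
  exists n (Q : 'I_n -> submodClosed M), irr_decomposition N Q.
Proof.
pose D n := exists Q : 'I_n -> submodClosed M,
    (forall i, irreducible_sub (Q i)) /\
    forall x, x \in N <-> forall i, x \in Q i.
have ex_n : exists n, `[< D n >].
  have [T [Q [irrQ NQ]]] := exists_irreducible_decomposition N.
  exists #|T|; apply/asboolP; exists (Q \o enum_val); split=> [i|x] //=.
  by rewrite NQ; split=> h i; [exact: h|rewrite -(enum_rankK i); exact: h].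
have [n /asboolP[Q [irrQ NQ]] min_n] := ex_minnP ex_n.
exists n, Q; split=> // j; apply: contrapT => noy.
case: n Q irrQ NQ min_n j noy => [|n] Q irrQ NQ min_n j noy.
  by case: (j).
suff /asboolP/min_n : D n by rewrite ltnn.
exists (Q \o lift j); split=> [i|x] //=; rewrite NQ; split=> [h i //|h i].
have xQ k : k != j -> x \in Q k.
  by rewrite eq_sym => /unlift_some[k' -> _]; exact: h.
have [->|/xQ//] := eqVneq i j.
by apply/negPn/negP => xQj; apply: noy; exists x.
Qed.

Lemma frame_component T N (Q : T -> submodClosed M) p z q (P : submodClosed M) :
    socle_frame N Q p z ->
    (forall x, x \in P <-> forall i, p i = q -> x \in Q i) ->
  socle_frame P (fun i : {i | p i == q} => Q (sval i))
    (fun i => p (sval i)) (fun i => z (sval i)).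
Proof.
move=> [irrQ _ primeQ notin killed inQ] memP; split=> //.
- move=> x; rewrite memP; split=> [h [i /= /eqP]|h i /eqP pi]; first exact: h.
  exact: h (exist _ i pi).
- by move=> i a; exact: killed.
- by move=> i j ij; exact: inQ.
Qed.

End Index.

Theorem lemma2p3 (R : comPzRingType) (M : lmodType R) (N : submodClosed M)
    (hR : noetherian R) (hM : finitely_generated [set: M]) :
  [/\ finite_set (Ass (mquot N)),
      forall p, Ass (mquot N) p -> finite_dimensional (socle p (mquot N)) &
      index_of_reducibility N
        (\sum_(p \in Ass (mquot N)) vdim (socle p (mquot N)))%N] /\
  exists Np : spec R -> submodClosed M,
    (forall p, Ass (mquot N) p ->
       primary p (Np p) /\
       index_of_reducibility (Np p) (vdim (socle p (mquot N)))) /\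
    irredundant_primary_decomposition N (Ass (mquot N)) Np.
Proof.
have noethM := noetherian_fg hR hM.
have [n [Q dec]] := exists_irr_decomposition noethM N.
have [p [z frame]] := irr_decomposition_frame hR noethM dec.
have AssN := frame_Ass frame.
split.
  split.
  - by rewrite AssN; exact/finite_image/finite_finset.
  - by move=> q _; exact: frame_finite_dimensional frame.
  - rewrite (frame_card hR frame); exact: irr_decomposition_index dec.
have /choice[Np memNp] : forall q, exists P : submodClosed M,
    forall x, x \in P <-> forall i, p i = q -> x \in Q i.
  move=> q; apply: submodule_comprehension => [i _|a x y xQ yQ i pi].
    exact: rpred0.
  by rewrite rpredD ?rpredZ ?xQ ?yQ.
have frameNp q := frame_component frame (memNp q).
have AssNp q : Ass (mquot N) q -> Ass (mquot (Np q)) = [set q].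
  rewrite AssN (frame_Ass (frameNp q)) => -[i _ /eqP pi].
  apply/seteqP; split=> r /= => [[[j pj] _ <-]|->]; first exact/eqP.
  by exists (exist _ i pi) => //=; exact/eqP.
exists Np; split=> [q Nq|].
  split; first exact: AssNp.
  rewrite (frame_vdim hR q frame) -card_sig.
  exact/irr_decomposition_index/frame_irr_decomposition/frameNp.
split.
- by rewrite AssN; exact/finite_image/finite_finset.
- by move=> q Nq; exists q; exact: AssNp.
- move=> q r Nq Nr qr; rewrite AssNp // AssNp // => e; apply: qr.
  by have : [set r] q by rewrite -e.
- apply/seteqP; split=> x /= => [/(frame_mem frame) xQ q _|xNp].
    by apply/memNp => i _; exact: xQ.
  apply/(frame_mem frame) => i; apply: (memNp (p i) x).1 => //.
  by apply: xNp; rewrite AssN; exists i.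
- move=> q; rewrite AssN => -[i _ <-] Ni.
  have : [set` N] (z i).
    rewrite Ni => r [_ /= rpi]; apply/memNp => j pj.
    by apply: (frame_in frame); apply: contra_notN rpi => /eqP ->; rewrite pj.
  move=> /(frame_mem frame)/(_ i) zQ.
  by have := frame_notin frame i; rewrite zQ.
Qed.
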